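(* Let $K$ be a global field and $\phi \in K(x)$ a rational function of degree $d \geq 2$ such that for every $n \geq 1$ the equation $\phi^n(x) = 0$ has $d^n$ distinct solutions in $\mathbb{P}^1(K^{\mathrm{sep}})$. If $A(\phi)$ is nontrivial, then $[\mathrm{Aut}(T(\phi)) : C(\phi)] = \infty$.
   Context: $T(\phi)$ is the complete rooted $d$-ary tree with root $(0,0)$, vertices at level $n\geq1$ the pairs $(n,y)$ with $\phi^n(y) = 0$, and parent of $(n,y)$ equal to $(n-1,\phi(y))$. $A(\phi)$ is the group of Möbius transformations $\mu$ (elements of $\mathrm{PGL}_2(\overline{K})$) satisfying $\mu \circ \phi = \phi \circ \mu$ and $\mu(0) = 0$; each such $\mu$ permutes $\phi^{-n}(0)$ for every $n$, giving an embedding $A(\phi) \hookrightarrow \mathrm{Aut}(T(\phi))$ via $(n,y) \mapsto (n,\mu(y))$. $C(\phi)$ is the centralizer of (the image of) $A(\phi)$ in $\mathrm{Aut}(T(\phi))$. *)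

(* Defs.v *)
From HB Require Import structures.
From mathcomp Require Import all_boot all_algebra all_field.
From mathcomp Require Import ring.
From mathcomp Require Import boolp classical_sets functions cardinality.

Set Implicit Arguments.
Unset Strict Implicit.
Unset Printing Implicit Defensive.

Import GRing.Theory.
Local Open Scope classical_set_scope.
Local Open Scope ring_scope.

Definition number_field (K : fieldType) : Prop :=
  exists (E : fieldExtType rat) (f : {rmorphism E -> K}), bijective f.

Definition global_function_field (K : fieldType) : Prop :=
  exists2 p : nat, prime p &
  exists (E : fieldExtType {fraction {poly 'F_p}}) (f : {rmorphism E -> K}),
    bijective f.

Definition global_field (K : fieldType) : Prop :=
  number_field K \/ global_function_field K.

(* [Kbar] is already algebraically closed by its type. *)
Definition algebraic_closure (K : fieldType) (Kbar : closedFieldType)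
  (iota : {rmorphism K -> Kbar}) : Prop :=
  forall x : Kbar, algebraicOver iota x.

(* The irreducible polynomial [p] is, up to a scalar, the minimal polynomial of
   [x], so this says that [x] lies in the separable closure of [K]. *)
Definition in_Ksep (K : fieldType) (Kbar : closedFieldType)
  (iota : {rmorphism K -> Kbar}) (x : Kbar) : Prop :=
  exists p : {poly K},
    [/\ irreducible_poly p, separable_poly p & root (map_poly iota p) x].

(* The projective line over F: [Some x] is (x : 1), [None] is infinity. *)
Notation P1 F := (option F).

Definition in_P1Ksep (K : fieldType) (Kbar : closedFieldType)
  (iota : {rmorphism K -> Kbar}) (y : P1 Kbar) : Prop :=
  if y is Some x then in_Ksep iota x else True.

Section RationalFunctions.
Variable K : fieldType.
Implicit Types phi : {fraction {poly K}}.

(* The representative chosen by the quotient need not be in lowest terms. *)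
Definition ratnum phi : {poly K} :=
  let r := frac (repr phi) in r.1 %/ gcdp r.1 r.2.

Definition ratden phi : {poly K} :=
  let r := frac (repr phi) in r.2 %/ gcdp r.1 r.2.

Definition ratdeg phi : nat :=
  (maxn (size (ratnum phi)) (size (ratden phi))).-1.

Lemma ratden_neq0 phi : ratden phi != 0.
Proof.
rewrite /ratden dvdp_div_eq0 ?dvdp_gcdr //; exact: denom_ratioP.
Qed.

Lemma coprimep_ratnum_ratden phi : coprimep (ratnum phi) (ratden phi).
Proof. by apply: coprimep_div_gcd; rewrite denom_ratioP orbT. Qed.

Lemma ratnum_ratdenE phi :
  phi = FracField.tofrac (ratnum phi) / FracField.tofrac (ratden phi).
Proof.
have dn0 := ratden_neq0 phi.
apply: (canRL (mulfK _)); first by rewrite tofrac_eq0.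
set r := repr phi.
have phiE : phi * FracField.tofrac (frac r).2 = FracField.tofrac (frac r).1.
  rewrite -[phi in LHS]reprK -/r.
  rewrite [FracField.tofrac (frac r).2]piE [FracField.tofrac (frac r).1]piE.
  rewrite -[LHS]/(FracField.mul _ _) piE; apply/eqP; rewrite piE /=.
  rewrite /FracField.equivf /FracField.mulf.
  rewrite !numden_Ratio ?oner_neq0 ?mulr1 ?denom_ratioP //.
  by rewrite mulrC.
have g0 : FracField.tofrac (gcdp (frac r).1 (frac r).2) != 0.
  by rewrite tofrac_eq0 gcdp_eq0 negb_and denom_ratioP orbT.
apply: (mulIf g0); rewrite -mulrA -!rmorphM /=.
by rewrite !divpK ?dvdp_gcdl ?dvdp_gcdr.
Qed.

End RationalFunctions.

(* For coprime p and q, the self-map (x : 1) |-> (p(x) : q(x)) of the projective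
   line.  Homogenizing in degree m = max (deg p, deg q), the image of infinity
   is (p_m : q_m). *)
Definition ratmap (F : fieldType) (p q : {poly F}) (y : P1 F) : P1 F :=
  match y with
  | Some x => if q.[x] == 0 then None else Some (p.[x] / q.[x])
  | None => let m := (maxn (size p) (size q)).-1 in
            if q`_m == 0 then None else Some (p`_m / q`_m)
  end.

Definition P1map (K : fieldType) (Kbar : closedFieldType)
  (iota : {rmorphism K -> Kbar}) (phi : {fraction {poly K}}) :
  P1 Kbar -> P1 Kbar :=
  ratmap (map_poly iota (ratnum phi)) (map_poly iota (ratden phi)).

Definition mobius (F : fieldType) (M : 'M[F]_2) (y : P1 F) : P1 F :=
  let a := M 0 0 in let b := M 0 1 in
  let c := M 1 0 in let d := M 1 1 in
  match y with
  | Some x => if c * x + d == 0 then None else Some ((a * x + b) / (c * x + d))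
  | None => if c == 0 then None else Some (a / c)
  end.

Lemma mobius_cancel (F : fieldType) (M N : 'M[F]_2) :
  M 0 0 * M 1 1 - M 0 1 * M 1 0 != 0 ->
  N 0 0 = M 1 1 -> N 0 1 = - M 0 1 -> N 1 0 = - M 1 0 -> N 1 1 = M 0 0 ->
  cancel (mobius M) (mobius N).
Proof.
move=> D N00 N01 N10 N11 y.
rewrite /mobius N00 N01 N10 N11.
move: (M 0 0) (M 0 1) (M 1 0) (M 1 1) D => a b c d D.
case: y => [x|].
  have [e0|e0] := eqVneq (c * x + d) 0.
    have c0 : c != 0.
      apply: contraNneq D => c0; move: e0; rewrite c0 mul0r add0r => ->.
      by rewrite !mulr0 subrr.
    rewrite oppr_eq0 (negPf c0); congr Some.
    have -> : d = - (c * x) by apply/eqP; rewrite -addr_eq0 addrC e0.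
    by rewrite invrN mulrNN mulrC mulKf.
  have -> : - c * ((a * x + b) / (c * x + d)) + a = (a * d - b * c) / (c * x + d).
    by field.
  rewrite mulf_eq0 invr_eq0 (negPf D) (negPf e0) /=; congr Some.
  by field; rewrite D e0.
have [c0|c0] := eqVneq c 0; first by rewrite c0 oppr0 eqxx.
rewrite (_ : - c * (a / c) + a = 0) ?eqxx //; by field.
Qed.

(* PGL_2(F), realized as the group of transformations it induces on the
   projective line: two invertible matrices induce the same transformation
   exactly when they are proportional. *)
Definition PGL2 (F : fieldType) : set (P1 F -> P1 F) :=
  [set mu | exists2 M : 'M[F]_2, M \in unitmx & mu = mobius M].

Lemma det_mx22 (F : fieldType) (M : 'M[F]_2) :
  \det M = M 0 0 * M 1 1 - M 0 1 * M 1 0.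
Proof.
rewrite (expand_det_row _ 0) !big_ord_recl big_ord0 addr0 /cofactor !det_mx11.
rewrite !mxE /= expr0 expr1 mul1r mulN1r mulrN.
by congr (M _ _ * M _ _ - M _ _ * M _ _); apply/val_inj.
Qed.

Lemma PGL2_inv (F : fieldType) (mu : P1 F -> P1 F) :
  PGL2 mu -> exists nu, [/\ PGL2 nu, cancel mu nu & cancel nu mu].
Proof.
case=> M; rewrite unitmxE unitfE => detM ->.
pose N : 'M[F]_2 :=
  \matrix_(i, j) if i == j then M (rev_ord i) (rev_ord j) else - M i j.
have D : M 0 0 * M 1 1 - M 0 1 * M 1 0 != 0 by rewrite -det_mx22.
have eqs : [/\ N 0 0 = M 1 1, N 0 1 = - M 0 1, N 1 0 = - M 1 0 & N 1 1 = M 0 0].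
  have r0 : rev_ord 0 = 1 :> 'I_2 by apply/val_inj.
  have r1 : rev_ord 1 = 0 :> 'I_2 by apply/val_inj.
  by rewrite !mxE /= r0 r1.
case: eqs => N00 N01 N10 N11.
have DN : N 0 0 * N 1 1 - N 0 1 * N 1 0 != 0.
  by rewrite N00 N01 N10 N11 mulrNN mulrC.
exists (mobius N); split.
- by exists N; rewrite // unitmxE unitfE det_mx22.
- exact: mobius_cancel.
- by apply: mobius_cancel DN _ _ _ _; rewrite ?N00 ?N01 ?N10 ?N11 ?opprK.
Qed.

Section Tree.
Variables (F : fieldType) (f : P1 F -> P1 F).

(* The group A(f) of Moebius transformations fixing 0 and commuting with f. *)
Definition commuting_mobius : set (P1 F -> P1 F) :=
  [set mu | [/\ PGL2 mu, mu \o f = f \o mu & mu (Some 0) = Some 0]].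

Definition tree : Type := {v : nat * P1 F | iter v.1 f v.2 == Some 0}.

Definition tree_root : tree := exist _ (0%N, Some 0) (eqxx _).

(* [u] is the parent of [v]. *)
Definition parent_of (u v : tree) : Prop :=
  (val v).1 = (val u).1.+1 /\ (val u).2 = f (val v).2.

(* The group law on these automorphisms is composition of functions. *)
Definition tree_aut : set (tree -> tree) :=
  [set s : tree -> tree |
    [/\ bijective s, s tree_root = tree_root
      & forall u v, parent_of (s u) (s v) <-> parent_of u v]].

Lemma commuting_mobius_tree (mu : P1 F -> P1 F) (v : tree) :
  commuting_mobius mu -> iter (val v).1 f (mu (val v).2) == Some 0.
Proof.
case=> _ muf mu0; case: v => -[n y] /= /eqP fy0.
suff -> : iter n f (mu y) = mu (iter n f y) by rewrite fy0 mu0.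
by elim: n {fy0} => //= n ->; exact/esym/(congr1 (@^~ _) muf).
Qed.

Definition tree_action (mu : P1 F -> P1 F) (Amu : commuting_mobius mu)
  (v : tree) : tree :=
  exist _ ((val v).1, mu (val v).2) (commuting_mobius_tree v Amu).

Definition commuting_mobius_image : set (tree -> tree) :=
  [set s : tree -> tree |
    exists mu (Amu : commuting_mobius mu), s = tree_action Amu].

Lemma commuting_mobius_image_sub : commuting_mobius_image `<=` tree_aut.
Proof.
move=> _ [mu [Amu ->]]; case: (Amu) => Pmu muf mu0.
have [nu [Pnu muK nuK]] := PGL2_inv Pmu.
have Anu : commuting_mobius nu.
  split=> //; last by rewrite -mu0 muK.
  apply/funext => y /=; apply: (can_inj muK); rewrite nuK.
  by rewrite -[mu (f _)]/((mu \o f) _) muf /= nuK.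
split.
- exists (tree_action Anu) => v; apply: val_inj; case: v => -[n y] h /=.
    by rewrite muK.
  by rewrite nuK.
- by apply: val_inj; rewrite /= mu0.
- move=> u v; rewrite /parent_of /=; split=> -[-> e]; split=> //.
    apply: (can_inj muK); rewrite e; exact/esym/(congr1 (@^~ _) muf).
  rewrite e; exact: (congr1 (@^~ _) muf).
Qed.

Definition tree_centralizer : set (tree -> tree) :=
  [set s : tree -> tree |
    tree_aut s /\ forall t, commuting_mobius_image t -> s \o t = t \o s].

End Tree.

Arguments commuting_mobius {F} f _.
Arguments tree_aut {F} f _.
Arguments tree_centralizer {F} f _.

Definition left_coset (T : Type) (s : T -> T) (C : set (T -> T)) :
  set (T -> T) := [set s \o c | c in C].

Definition infinite_index (T : Type) (G C : set (T -> T)) : Prop :=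
  infinite_set [set left_coset s C | s in G].

(* Main.v *)
(** A nontrivial mu in A(phi) fixes at most two points of the projective line,
hence moves some vertex v at every level n >= 2.  Let s_n be the involution of
the tree that exchanges two children w, w' of v together with the subtrees
below them and fixes everything outside the subtree below v.  As mu v <> v,
s_n fixes mu w, so s_n does not commute with mu already at level n + 1, where
every s_m with m > n acts trivially.  Hence the s_n lie in pairwise distinct
cosets of C(phi). *)

Require Import Defs.
From HB Require Import structures.
From mathcomp Require Import all_boot all_algebra all_field.
From mathcomp Require Import ring.
From mathcomp Require Import boolp classical_sets functions cardinality.

Set Implicit Arguments.
Unset Strict Implicit.
Unset Printing Implicit Defensive.

Import GRing.Theory.
Local Open Scope classical_set_scope.
Local Open Scope ring_scope.

(** * Counting iterated preimages *)

Section Counting.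
Variables (T : eqType) (f : T -> T) (r0 : T) (d : nat).

Lemma size_sum_fibers (s t : seq T) :
  uniq t -> {subset map f s <= t} ->
  size s = (\sum_(z <- t) count (fun y => f y == z) s)%N.
Proof.
move=> ut; elim: s => [|y s IHs] sub /=; first by rewrite big1.
rewrite big_split /= -IHs; last by move=> z zs; apply: sub; rewrite inE zs orbT.
rewrite -add1n; congr (_ + _)%N; have fyt : f y \in t by apply: sub; rewrite mem_head.
transitivity (count_mem (f y) t); first by rewrite count_uniq_mem // fyt.
rewrite -sum1_count big_mkcond; apply: eq_bigr => z _ /=; rewrite eq_sym.
by case: (f y == z).
Qed.

Hypothesis fiber_le : forall z s, uniq s -> all (fun y => f y == z) s ->
  (size s <= d)%N.

Lemma count_fiber_le z s : uniq s -> (count (fun y => f y == z) s <= d)%N.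
Proof.
move=> us; rewrite -size_filter; apply: (@fiber_le z); first exact: filter_uniq.
exact: filter_all.
Qed.

Lemma preimage_le n s : uniq s -> all (fun y => iter n f y == r0) s ->
  (size s <= d ^ n)%N.
Proof.
elim: n s => [|n IHn] s us /allP sZ.
  have : {subset s <= [:: r0]} by move=> y /sZ; rewrite inE.
  exact: uniq_leq_size us.
rewrite (size_sum_fibers (undup_uniq (map f s))); last first.
  by move=> z; rewrite mem_undup.
apply: (@leq_trans (\sum_(z <- undup (map f s)) d)%N).
  by apply: leq_sum => z _; exact: count_fiber_le.
rewrite big_const_seq count_predT iter_addn_0 expnS leq_mul2l.
rewrite IHn ?orbT ?undup_uniq //; apply/allP => z; rewrite mem_undup.
by case/mapP => y /sZ; rewrite iterSr => yZ ->.
Qed.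

Hypothesis preimage_ex : forall n, (1 <= n)%N -> exists s : seq T,
  [/\ uniq s, size s = (d ^ n)%N & all (fun y => iter n f y == r0) s].

(** The [d ^ n] solutions supplied by [preimage_ex] exhaust the level: one more would contradict
    [preimage_le]. *)
Lemma preimage_enum n : exists s : seq T,
  [/\ uniq s, size s = (d ^ n)%N & forall y, (y \in s) = (iter n f y == r0)].
Proof.
have [s [us szs sZ]] : exists s : seq T,
    [/\ uniq s, size s = (d ^ n)%N & all (fun y => iter n f y == r0) s].
  by case: n => [|n]; [exists [:: r0]; rewrite /= eqxx | exact: preimage_ex].
exists s; split=> // y; apply/idP/idP => [/(allP sZ) //|yZ].
apply: contraT => ys.
have := @preimage_le n (y :: s); rewrite /= ys us yZ sZ szs ltnn.
by move=> /(_ isT isT).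
Qed.

(** The [d ^ n.+1] points of level [n.+1] are spread over [d ^ n] fibers of at most [d] points each,
    so every one of these fibers is full. *)
Lemma fiber_enum n z : iter n f z = r0 -> exists s : seq T,
  [/\ uniq s, size s = d & forall y, (y \in s) = (f y == z)].
Proof.
move=> zZ; have [s [us szs sE]] := preimage_enum n.
have [t [ut szt tE]] := preimage_enum n.+1.
exists [seq y <- t | f y == z]; split; first exact: filter_uniq.
  have sub : {subset map f t <= s}.
    by move=> _ /mapP[y yt ->]; move: yt; rewrite tE sE iterSr.
  have zs : z \in s by rewrite sE zZ.
  have := size_sum_fibers us sub; rewrite szt (bigD1_seq z) //= => sum_eq.
  apply/eqP; rewrite size_filter eqn_leq count_fiber_le //=.
  have rest : (\sum_(i <- s | i != z) count (fun y => f y == i) t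
               <= \sum_(i <- s | i != z) d)%N.
    by apply: leq_sum => i _; exact: count_fiber_le.
  have total : (d + \sum_(i <- s | i != z) d)%N = (d ^ n.+1)%N.
    rewrite -(bigD1_seq z (op := addn) (F := fun=> d)) //=.
    by rewrite big_const_seq count_predT iter_addn_0 szs expnS.
  by rewrite -(leq_add2r (\sum_(i <- s | i != z) d)%N) total sum_eq leq_add2l.
move=> y; rewrite mem_filter tE iterSr.
by case: eqP => //= ->; rewrite zZ eqxx.
Qed.

End Counting.

(** * Level-wise involutions exchanging two sibling subtrees *)

Definition swap01 (k : nat) : nat :=
  match k with 0 => 1 | 1 => 0 | _ => k end.

Lemma swap01K : involutive swap01. Proof. by case=> [|[|k]]. Qed.

Lemma swap01_lt d k : (2 <= d)%N -> (k < d)%N -> (swap01 k < d)%N.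
Proof. by case: k => [|[|k]] //= /ltnW. Qed.

Section Swap.
Variables (T : eqType) (f : T -> T) (r0 : T) (d : nat) (L : T -> seq T).
Hypothesis d_ge2 : (2 <= d)%N.
Hypothesis LP : forall n z, iter n f z = r0 ->
  [/\ uniq (L z), size (L z) = d & forall y, (y \in L z) = (f y == z)].

(* The numbering [L] of the children of each vertex identifies level m with
   words of length m; [swap n v m] is the action on level m of the automorphism
   exchanging the letters 0 and 1 directly below the vertex v of level n. *)
Fixpoint swap (n : nat) (v : T) (m : nat) (y : T) : T :=
  if m is m'.+1 then
    let k := index y (L (f y)) in
    nth r0 (L (swap n v m' (f y)))
      (if (m' == n) && (f y == v) then swap01 k else k)
  else y.

Lemma swapS n v m y (k := index y (L (f y))) :
  swap n v m.+1 y = nth r0 (L (swap n v m (f y)))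
    (if (m == n) && (f y == v) then swap01 k else k).
Proof. by []. Qed.

Arguments swap : simpl never.

Let child n y : iter n.+1 f y = r0 ->
  [/\ iter n f (f y) = r0, y \in L (f y) & (index y (L (f y)) < d)%N].
Proof.
rewrite iterSr => yZ; have [_ szL memL] := LP yZ.
have yL : y \in L (f y) by rewrite memL.
by split=> //; rewrite -[X in (_ < X)%N]szL index_mem.
Qed.

Let letter_lt b k : (k < d)%N -> ((if b then swap01 k else k) < d)%N.
Proof. by case: b => //; exact: swap01_lt. Qed.

(** The new letter is still below [d], so [nth] reads an actual entry of the list of children and
    never its default [r0]. *)
Lemma swap_parent n v m y : iter m.+1 f y = r0 ->
  iter m f (swap n v m (f y)) = r0 ->
  f (swap n v m.+1 y) = swap n v m (f y).
Proof.
move=> /child[_ _ lt_d] sZ; have [_ szL memL] := LP sZ.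
by apply/eqP; rewrite swapS -memL mem_nth // szL letter_lt.
Qed.

Lemma swap_mem n v m y : iter m f y = r0 -> iter m f (swap n v m y) = r0.
Proof.
elim: m y => // m IHm y yZ; have [/IHm fyZ _ _] := child yZ.
by rewrite iterSr swap_parent.
Qed.

Lemma swap_id n v m y : (m <= n)%N -> iter m f y = r0 -> swap n v m y = y.
Proof.
elim: m y => // m IHm y lt_mn /child[fyZ yL _].
by rewrite swapS (ltn_eqF lt_mn) IHm ?(ltnW lt_mn) // nth_index.
Qed.

Lemma swapK n v m y : iter m f y = r0 -> swap n v m (swap n v m y) = y.
Proof.
elim: m y => // m IHm y yZ; have [fyZ yL lt_d] := child yZ.
have sZ := swap_mem n v fyZ; have [uL szL _] := LP sZ.
rewrite [LHS]swapS swap_parent // IHm // swapS index_uniq ?szL ?letter_lt //.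
(* When [m = n], level [m] is fixed pointwise, so [y] and its image pass the same test [f y == v],
   and [swap01] is applied twice or not at all. *)
have [eq_mn /=|_ /=] := eqVneq m n; last exact: nth_index.
rewrite swap_id ?eq_mn -?eq_mn //.
by case: eqP => _; rewrite ?swap01K nth_index.
Qed.

Lemma swap_moved n v : iter n f v = r0 -> exists y,
  [/\ f y = v, iter n.+1 f y = r0 & swap n v n.+1 y != y].
Proof.
move=> vZ; have [uL szL memL] := LP vZ.
have d_gt0 : (0 < d)%N by exact: ltnW.
(* The child with letter 0 goes to the one with letter 1, which exists and differs from it because
   [2 <= d]. *)
exists (nth r0 (L v) 0).
have fy : f (nth r0 (L v) 0) = v by apply/eqP; rewrite -memL mem_nth ?szL.
split=> //; first by rewrite iterSr fy.
by rewrite swapS fy !eqxx /= swap_id // index_uniq ?szL //= nth_uniq ?szL.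
Qed.

Lemma swap_fixed n v y : iter n.+1 f y = r0 -> f y != v -> swap n v n.+1 y = y.
Proof.
move=> /child[fyZ yL _] fyv.
by rewrite swapS eqxx (negPf fyv) /= swap_id // nth_index.
Qed.

End Swap.

Arguments swap {T} f r0 L n v m y : simpl never.

(** * The induced tree automorphisms and their cosets *)

Section TreeSwap.
Variables (F : fieldType) (f : P1 F -> P1 F) (d : nat).
Variable L : P1 F -> seq (P1 F).
Hypothesis d_ge2 : (2 <= d)%N.
Hypothesis LP : forall n z, iter n f z = Some 0 ->
  [/\ uniq (L z), size (L z) = d & forall y, (y \in L z) = (f y == z)].

Local Notation level := (swap f (Some 0) L).

Lemma tree_swap_subproof n v (u : tree f) :
  iter (val u).1 f (level n v (val u).1 (val u).2) == Some 0.
Proof. by apply/eqP; apply: (swap_mem d_ge2 LP); exact/eqP/(valP u). Qed.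

Definition tree_swap n v (u : tree f) : tree f :=
  exist _ ((val u).1, level n v (val u).1 (val u).2) (tree_swap_subproof n v u).

Lemma tree_swapK n v : involutive (tree_swap n v).
Proof.
move=> u; apply: val_inj; rewrite /= (swapK d_ge2 LP); last exact/eqP/(valP u).
by case: (val u).
Qed.

Lemma tree_swap_aut n v : tree_aut f (tree_swap n v).
Proof.
have parent_swap u w : parent_of u w ->
    parent_of (tree_swap n v u) (tree_swap n v w).
  case: u w => [[i x] ux] [[j y] wy]; rewrite /parent_of /= => -[ji ->].
  split=> //; rewrite ji in wy *.
  rewrite (swap_parent d_ge2 LP) //; first exact/eqP.
  by apply: (swap_mem d_ge2 LP); rewrite -iterSr; exact/eqP.
split; first exact: inv_bij (@tree_swapK n v).
- exact: val_inj.
- move=> u w; split=> [/parent_swap|]; last exact: parent_swap.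
  by rewrite !tree_swapK.
Qed.

Variable mu : P1 F -> P1 F.
Hypothesis Amu : commuting_mobius f mu.

Lemma tree_swap_coset_neq n n' v v' : (n < n')%N -> iter n f v = Some 0 ->
  mu v != v ->
  left_coset (tree_swap n v) (tree_centralizer f) <>
  left_coset (tree_swap n' v') (tree_centralizer f).
Proof.
move=> lt_nn' vZ muv eqC.
(* The first coset contains its representative; reading this in the second coset gives a
   centralizing [c] with [tree_swap n v] equal to [tree_swap n' v'] after [c]. *)
have : left_coset (tree_swap n v) (tree_centralizer f) (tree_swap n v).
  exists id => //; split=> //; split=> //; exact: inv_bij.
rewrite eqC => -[c [_ cC] cE].
have {}cE u : c u = tree_swap n' v' (tree_swap n v u).
  by rewrite -cE /= tree_swapK.
have [y [fy yZ ymoved]] := swap_moved d_ge2 LP vZ.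
have [Pmu muf _] := Amu; have [nu [_ muK _]] := PGL2_inv Pmu.
have fmu : f (mu y) = mu v by rewrite -fy -[RHS]/((mu \o f) y) muf.
pose w : tree f := exist _ (n.+1, y) (introT eqP yZ).
have muyZ : iter n.+1 f (mu y) = Some 0.
  exact/eqP/(commuting_mobius_tree w Amu).
(* Commutation of [c] with [mu] is tested at the moved child [y] of [v]. Since [f (mu y) = mu v] is
   not [v], the first swap fixes [mu y]; the second is trivial on level [n.+1 <= n']. What remains
   is that [mu y] equals [mu] of the swapped [y]. *)
have := cC _ (ex_intro _ mu (ex_intro _ Amu erefl)).
move/(congr1 (fun g => (val (g w)).2)); rewrite /= !cE /=.
rewrite (swap_fixed LP) ?fmu //.
have syZ := swap_mem d_ge2 LP n v yZ.
rewrite ![swap _ _ _ n' _ _ _](swap_id LP) // => /(can_inj muK) sy.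
by rewrite -sy eqxx in ymoved.
Qed.

End TreeSwap.

(** * Bounds on fibers and fixed points on the projective line *)

(* [r] is homogenized in degree [m], so that infinity is a root when [r`_m = 0]. *)
Lemma proj_roots_le (F : fieldType) (r : {poly F}) m (s : seq (P1 F)) :
  r != 0 -> (size r <= m.+1)%N -> uniq s ->
  all (fun y => if y is Some x then root r x else r`_m == 0) s ->
  (size s <= m)%N.
Proof.
move=> r0 szr us rs.
have roots_le t : uniq t -> {subset t <= s} -> None \notin t ->
    (size t < size r)%N.
  move=> ut ts tN.
  have tE : map Some (pmap id t) = t.
    rewrite pmapS_filter map_id; apply/all_filterP/allP => -[x|] //.
    by rewrite (negPf tN).
  rewrite -tE size_map; apply: max_poly_roots => //; last first.
    by rewrite -(map_inj_uniq Some_inj) tE.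
  by apply/allP => x; rewrite mem_pmap map_id => /ts/(allP rs).
have [sN|sN] := boolP (None \in s); last first.
  by rewrite -ltnS; apply: leq_trans szr; exact: roots_le.
(* If infinity is a root, the degree of [r] drops below [m], which compensates for the extra
   point. *)
have rm : r`_m = 0 by apply/eqP; exact: (allP rs) sN.
have szr' : (size r <= m)%N.
  apply/leq_sizeP => j; rewrite leq_eqVlt => /predU1P[<- //|lt_mj].
  exact: (leq_sizeP _ _ szr).
apply: leq_trans szr'; rewrite (perm_size (perm_to_rem sN)) /=.
apply: roots_le; first exact: rem_uniq.
- exact: mem_rem.
- by rewrite mem_rem_uniqF.
Qed.

(** The fiber over [Some c] lies among the projective roots of [p - c *: q], the one over infinity
    among those of [q]. Were such a polynomial zero, coprimality would make both [p] and [q]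
    constant. *)
Lemma ratmap_fiber_le (F : fieldType) (p q : {poly F}) (z : P1 F) s :
  coprimep p q -> (1 < maxn (size p) (size q))%N ->
  uniq s -> all (fun y => ratmap p q y == z) s ->
  (size s <= (maxn (size p) (size q)).-1)%N.
Proof.
set m := (maxn _ _).-1 => cpq sz us /allP fs.
have szm : maxn (size p) (size q) = m.+1 by rewrite prednK ?ltnS // ltnW.
have [szp szq] : (size p <= m.+1)%N /\ (size q <= m.+1)%N.
  by rewrite -szm leq_maxl leq_maxr.
have size1 : ~~ ((size p <= 1)%N && (size q <= 1)%N) by rewrite -geq_max -ltnNge.
case: z fs => [c|] fs; last first.
  apply: (@proj_roots_le _ q) => //.
    apply: contraNneq size1 => q0; move: cpq.
    by rewrite q0 coprimep0 -size_poly_eq1 size_poly0 => /eqP->.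
  by apply/allP => -[x|] /fs; rewrite /= ?rootE; case: ifP.
apply: (@proj_roots_le _ (p - c *: q)) => //.
- apply: contraNneq size1 => /subr0_eq pE; move: cpq; rewrite pE.
  have [->|c0] := eqVneq c 0.
    by rewrite scale0r coprime0p -size_poly_eq1 size_poly0 => /eqP->.
  by rewrite coprimepZl // coprimepp size_scale // => /eqP->.
- rewrite (leq_trans (size_polyD _ _)) // size_polyN geq_max szp.
  exact: leq_trans (size_scale_leq _ _) szq.
- apply/allP => -[x|] /fs /=.
    rewrite rootE !hornerE; case: ifPn => // q0 /eqP[/(canRL (divfK q0))->].
    by rewrite subrr.
  rewrite coefB coefZ; case: ifPn => // q0 /eqP[/(canRL (divfK q0))->].
  by rewrite subrr.
Qed.

(** Fixed points are projective roots of the quadratic form with affine part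
    [c x^2 + (d - a) x - b], which vanishes identically only if the matrix is scalar. *)
Lemma mobius_fixed_le (F : fieldType) (M : 'M[F]_2) s :
  M \in unitmx -> mobius M <> id ->
  uniq s -> all (fun y => mobius M y == y) s -> (size s <= 2)%N.
Proof.
rewrite unitmxE unitfE det_mx22 /mobius => D Mid us /allP fs.
move: (M 0 0) (M 0 1) (M 1 0) (M 1 1) D Mid fs => a b c d D Mid fs.
pose r := Poly [:: - b; d - a; c].
apply: (@proj_roots_le _ r) => //; last 1 first.
- apply/allP => y /fs; case: y => [x|]; last by rewrite coef_Poly /=; case: ifP.
  rewrite /root horner_Poly /= !mul0r !add0r.
  case: ifPn => // e0 /eqP[]/(canRL (divfK e0)) axb.
  by apply/eqP; rewrite -[b](addKr (a * x)) axb; ring.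
- apply/eqP => r0; apply: Mid.
  have coef i : [:: - b; d - a; c]`_i = 0 by rewrite -coef_Poly -/r r0 coef0.
  have b0 : b = 0 by apply/eqP; rewrite -oppr_eq0; apply/eqP/(coef 0%N).
  have da : d = a by apply/eqP; rewrite -subr_eq0; apply/eqP/(coef 1%N).
  have c0 : c = 0 := coef 2%N.
  move: D; rewrite b0 c0 da mul0r subr0 mulf_eq0 orbb => a0.
  apply/funext => -[x|]; last by rewrite eqxx.
  by rewrite mul0r add0r (negPf a0) addr0 mulrC mulKf.
- exact: size_Poly.
Qed.

Theorem theorem13 (K : fieldType) (Kbar : closedFieldType)
  (iota : {rmorphism K -> Kbar}) (phi : {fraction {poly K}}) (d : nat)
  (hK : global_field K) (hKbar : algebraic_closure iota)
  (hdeg : ratdeg phi = d) (hd : (2 <= d)%N)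
  (hphi : forall n : nat, (1 <= n)%N ->
     ([set y : P1 Kbar | in_P1Ksep iota y /\ iter n (P1map iota phi) y = Some 0]
       #= `I_(d ^ n))%card)
  (hA : exists2 mu, commuting_mobius (P1map iota phi) mu & mu <> id) :
  infinite_index (tree_aut (P1map iota phi))
                 (tree_centralizer (P1map iota phi)).
Proof.
set f := P1map iota phi; have [mu Amu mu_id] := hA.
have szE : maxn (size (map_poly iota (ratnum phi)))
                (size (map_poly iota (ratden phi))) = d.+1.
  rewrite !size_map_poly -hdeg prednK //.
  by rewrite leq_max orbC lt0n size_poly_eq0 ratden_neq0.
have fiber_le z s : uniq s -> all (fun y => f y == z) s -> (size s <= d)%N.
  move=> us fs; rewrite -[d]/(d.+1.-1) -szE; apply: ratmap_fiber_le us fs.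
    by rewrite coprimep_map coprimep_ratnum_ratden.
  by rewrite szE ltnS ltnW.
have preimage_ex n : (1 <= n)%N -> exists s : seq (P1 Kbar),
    [/\ uniq s, size s = (d ^ n)%N & all (fun y => iter n f y == Some 0) s].
  (* The list enumerates the solutions over the separable closure; [preimage_enum] then shows that
     it contains every solution in [P1 Kbar]. *)
  move=> n_gt0; have cardZ := hphi n n_gt0.
  have ex_card := ex_intro (fun k => is_true (_ #= `I_k)%card) _ cardZ.
  have /finite_fsetP[X XE] := iffRL (finite_setP _) ex_card.
  exists (finmap.enum_fset X); split; first exact: finmap.fset_uniq.
    by apply/card_eq_fsetP; rewrite -XE.
  apply/allP => y yX; have : (mkset (fun x => x \in finmap.enum_fset X)) y by [].
  by rewrite -[mkset _]XE => -[_ ->].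
(* The implication sits under the existential so that [choice] yields a total [L], with the empty
   list at points outside the tree. *)
have fiber_ex z : exists s : seq (P1 Kbar), (exists n, iter n f z = Some 0) ->
    [/\ uniq s, size s = d & forall y, (y \in s) = (f y == z)].
  have [[n zZ]|nZ] := pselect (exists n, iter n f z = Some 0).
    by have [s sP] := fiber_enum fiber_le preimage_ex zZ; exists s.
  by exists [::].
have [L LP] := choice fiber_ex.
have {}LP n z (zZ : iter n f z = Some 0) := LP z (ex_intro _ n zZ).
(* The shift by 2 guarantees at least [2 ^ 2] vertices, more than the two points that [mu] can
   fix. *)
have moved n : exists v, iter n.+2 f v = Some 0 /\ mu v != v.
  have [s [us szs sE]] := preimage_enum fiber_le preimage_ex n.+2.
  have [|/allPn[v]] := boolP (all (fun y => mu y == y) s); last first.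
    by rewrite sE => /eqP; exists v.
  have [Pmu _ _] := Amu; case: Pmu => M uM muE; rewrite muE in mu_id *.
  move/(mobius_fixed_le uM mu_id us); rewrite szs leqNgt.
  have -> // : (2 < d ^ n.+2)%N.
  rewrite (@leq_trans (d ^ 2)) ?leq_pexp2l ?(ltnW hd) //.
  by rewrite (@leq_trans (2 ^ 2)) ?leq_exp2r.
have [v vP] := choice moved.
pose coset n := left_coset (tree_swap hd LP n.+2 (v n)) (tree_centralizer f).
have coset_inj : injective coset.
  have coset_lt m n : (m < n)%N -> coset m <> coset n.
    by move=> lt_mn; have [vZ muv] := vP m; exact: (tree_swap_coset_neq Amu _ vZ muv).
  move=> m n eq_mn; case: (ltngtP m n) => // /coset_lt; first by move/(_ eq_mn).
  by move/(_ (esym eq_mn)).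
(* Were there finitely many cosets, their preimage under the injective [coset], which is all of
   [nat], would be finite. *)
move=> fin; apply: infinite_nat.
have <- : coset @^-1` [set left_coset s (tree_centralizer f) | s in tree_aut f] = setT.
  apply/seteqP; split=> // n _; exists (tree_swap hd LP n.+2 (v n)) => //.
  exact: tree_swap_aut.
by apply: finite_preimage fin => m n _ _; exact: coset_inj.
Qed.
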